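(* Let $m$ and $n$ be natural numbers (positive integers), and let $\mathbb{C}^{m\times(n,m,m)}$ denote the space of all $m\times(n,m,m)$ triples. (a) If $m<n(1+\sqrt5)/2$, then there is exactly one $m\times(n,m,m)$ triple of the form $\mathcal{L}^{(l)}(F_{pq},0_p,0_p)$ (with integers $l\ge 0$ and $0\le p\le q$). All triples that are feedback similar to it form an open and everywhere dense set in $\mathbb{C}^{m\times(n,m,m)}$, and this set coincides with the set of all $m\times(n,m,m)$ triples that are rigid with respect to feedback similarity. (b) If $m>n(1+\sqrt5)/2$, then no $m\times(n,m,m)$ triple is rigid with respect to feedback similarity.
   Context: An $m\times(n,m,m)$ triple is a triple $(C,B,A)$ of complex matrices with $C\in\mathbb{C}^{m\times n}$, $B,A\in\mathbb{C}^{m\times m}$; the set of such triples is identified with $\mathbb{C}^{m(n+2m)}$ with its usual topology. Two such triples $(C,B,A)$ and $(C',B',A')$ are feedback similar if $[C'\ B'\ A']=S^{-1}[C\ B\ A]\begin{bmatrix}P&V&U\\0&S&0\\0&0&S\end{bmatrix}$ for some matrices $U,V\in\mathbb{C}^{n\times m}$ and nonsingular $P\in\mathbb{C}^{n\times n}$, $S\in\mathbb{C}^{m\times m}$. A triple $\mathcal{T}$ is rigid with respect to feedback similarity if there is a neighborhood of $\mathcal{T}$ in $\mathbb{C}^{m\times(n,m,m)}$ all of whose elements are feedback similar to $\mathcal{T}$. $0_{ab}$ denotes the $a\times b$ zero matrix, $0_a:=0_{aa}$; matrices with zero rows or zero columns are allowed (there is exactly one $0\times b$ and one $a\times 0$ matrix,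 regarded as zero matrices). For $0\le r\le l$, $F_{rl}:=[I_r\ \ 0_{r,l-r}]$. For a $p\times(q,p,p)$ triple $(C,B,A)$, $\mathcal{L}(C,B,A)$ is the $(2p+q)\times(p+q,2p+q,2p+q)$ triple $\left(\begin{bmatrix}I_{p+q}\\0_{p,p+q}\end{bmatrix},\ \begin{bmatrix}0_{p+q,q}&0_{p+q,p}&0_{p+q,p}\\0_{pq}&I_p&0_p\end{bmatrix},\ \begin{bmatrix}0_{p+q,q+2p}\\ C\ \ B\ \ A\end{bmatrix}\right)$, and $\mathcal{L}^{(i)}$ denotes the $i$-fold iterate of $\mathcal{L}$ ($\mathcal{L}^{(0)}$ is the identity). *)

(* Defs.v *)
From mathcomp Require Import all_boot all_order all_algebra.
From mathcomp Require Import complex reals.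
Set Implicit Arguments. Unset Strict Implicit. Unset Printing Implicit Defensive.
Import Order.TTheory GRing.Theory Num.Theory.
Local Open Scope ring_scope.

Section Triples.
Variable R : realType.
Notation C := (R[i]).

Definition triple (m n : nat) : Type := ('M[C]_(m, n) * 'M[C]_m * 'M[C]_m)%type.

Definition tC m n (T : triple m n) : 'M[C]_(m, n) := T.1.1.
Definition tB m n (T : triple m n) : 'M[C]_m := T.1.2.
Definition tA m n (T : triple m n) : 'M[C]_m := T.2.

Definition feedback_similar m n (T T' : triple m n) : Prop :=
  exists (U V : 'M[C]_(n, m)) (P : 'M[C]_n) (S : 'M[C]_m),
    P \in unitmx /\ S \in unitmx /\
    row_mx (tC T') (row_mx (tB T') (tA T')) =
      invmx S *m row_mx (tC T) (row_mx (tB T) (tA T)) *m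
        block_mx P (row_mx V U) 0 (block_mx S 0 0 S).

Definition near_triple m n (eps : C) (T T' : triple m n) : Prop :=
  (forall i j, `|tC T' i j - tC T i j| < eps) /\
  (forall i j, `|tB T' i j - tB T i j| < eps) /\
  (forall i j, `|tA T' i j - tA T i j| < eps).

Definition open_triples m n (S : triple m n -> Prop) : Prop :=
  forall T, S T -> exists2 eps : C, 0 < eps &
    forall T', near_triple eps T T' -> S T'.

Definition dense_triples m n (S : triple m n -> Prop) : Prop :=
  forall T (eps : C), 0 < eps -> exists T', near_triple eps T T' /\ S T'.

Definition rigid m n (T : triple m n) : Prop :=
  exists2 eps : C, 0 < eps &
    forall T', near_triple eps T T' -> feedback_similar T T'.

(* The operator L : p x (q,p,p) -> (2p+q) x (p+q, 2p+q, 2p+q),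
   with 2p+q written (p+q)+p. *)
Lemma L_dim_eq (p q : nat) : (q + p + p = p + q + p)%N.
Proof. by rewrite (addnC q p). Qed.

Definition Lop p q (T : triple p q) : triple (p + q + p) (p + q) :=
  (col_mx (1%:M : 'M[C]_(p + q)) (0 : 'M[C]_(p, p + q)),
   col_mx (0 : 'M[C]_(p + q, p + q + p))
     (castmx (erefl p, L_dim_eq p q)
        (row_mx (row_mx (0 : 'M[C]_(p, q)) (1%:M : 'M[C]_p)) (0 : 'M[C]_p))),
   col_mx (0 : 'M[C]_(p + q, p + q + p))
     (castmx (erefl p, L_dim_eq p q)
        (row_mx (row_mx (tC T) (tB T)) (tA T)))).

(* Triples of arbitrary size, so that L can be iterated. *)
Definition any_triple : Type := {d : nat * nat & triple d.1 d.2}.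

Definition Lsig (X : any_triple) : any_triple :=
  let: existT (p, q) T := X in
  existT (fun d : nat * nat => triple d.1 d.2) (p + q + p, p + q)%N (Lop T).

Definition Liter (l : nat) (X : any_triple) : any_triple := iter l Lsig X.

(* (F_pq, 0_p, 0_p) with F_pq = [I_p 0] (pid_mx p : 'M_(p,q), for p <= q). *)
Definition base_triple (p q : nat) : any_triple :=
  existT (fun d : nat * nat => triple d.1 d.2) (p, q)
    ((pid_mx p : 'M[C]_(p, q)), (0 : 'M[C]_p), (0 : 'M[C]_p)).

Definition is_L_form m n (T : triple m n) : Prop :=
  exists (l p q : nat), (p <= q)%N /\
    Liter l (base_triple p q) =
      existT (fun d : nat * nat => triple d.1 d.2) (m, n) T.

End Triples.

(* Main.v *)
(* A triple with C of full column rank is determined up to feedback similarity by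
   the compressions of B and A to coker C. When the rows of coker C and of their
   images under B are independent, completing them to a basis turns the triple
   into L(T') for a smaller triple T', with L preserving similarity. This normal
   form is reached after an arbitrarily small perturbation, and it depends
   continuously on the triple near L(T'), so L preserves rigidity and density of
   orbits. On sizes, L^-1 is (m, n) |-> (m - n, 2n - m), under which the condition
   m^2 < n^2 + mn (that is, m < n (1 + sqrt 5) / 2) is invariant and which ends at
   m <= n, where [I 0], 0, 0 is generic. If m^2 > n^2 + mn, the acting group has
   fewer parameters than the space of triples has coordinates, so no orbit
   contains an open set. *)
Require Import Defs.
From mathcomp Require Import all_boot all_order all_algebra.
From mathcomp Require Import complex reals.
From mathcomp Require Import ring lra zify.
From mathcomp Require Import mpoly.
From Stdlib Require Eqdep_dec.
Import Order.TTheory GRing.Theory Num.Theory.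
Local Open Scope ring_scope.
Set Implicit Arguments. Unset Strict Implicit. Unset Printing Implicit Defensive.

(** * Continuity of matrix operations *)

Section L1Norm.
Variable F : numFieldType.

(** Submultiplicative, and additive over blocks, so limits of block matrices reduce to limits of
    their blocks. *)
Definition l1 m n (A : 'M[F]_(m, n)) : F := \sum_i \sum_j `|A i j|.

Lemma l1_ge0 m n (A : 'M_(m, n)) : 0 <= l1 A.
Proof. by apply: sumr_ge0 => i _; apply: sumr_ge0 => j _. Qed.

Lemma l1_0 m n : l1 (0 : 'M_(m, n)) = 0.
Proof. by rewrite /l1 big1// => i _; rewrite big1// => j _; rewrite mxE normr0. Qed.

Lemma entry_le_l1 m n (A : 'M_(m, n)) i j : `|A i j| <= l1 A.
Proof.
rewrite /l1 (bigD1 i)//= (bigD1 j)//= -addrA lerDl addr_ge0//.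
  exact: sumr_ge0.
by apply: sumr_ge0 => k _; apply: sumr_ge0.
Qed.

Lemma l1_le_entry m n (A : 'M_(m, n)) d :
  (forall i j, `|A i j| <= d) -> l1 A <= (m * n)%:R * d.
Proof.
move=> Ad; rewrite /l1.
apply: (@le_trans _ _ (\sum_(i < m) \sum_(j < n) d)).
  by apply: ler_sum => i _; apply: ler_sum.
by rewrite !sumr_const !card_ord -mulrnA mulnC mulr_natl.
Qed.

Lemma l1_le0 m n (A : 'M_(m, n)) : l1 A <= 0 -> A = 0.
Proof.
move=> A0; apply/matrixP => i j; rewrite mxE; apply/eqP.
by rewrite -normr_le0 (le_trans (entry_le_l1 A i j)).
Qed.

Lemma l1D m n (A B : 'M_(m, n)) : l1 (A + B) <= l1 A + l1 B.
Proof.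
rewrite /l1 -big_split; apply: ler_sum => i _; rewrite -big_split.
by apply: ler_sum => j _; rewrite mxE ler_normD.
Qed.

Lemma l1Z m n a (A : 'M_(m, n)) : l1 (a *: A) = `|a| * l1 A.
Proof.
rewrite /l1 mulr_sumr; apply: eq_bigr => i _; rewrite mulr_sumr.
by apply: eq_bigr => j _; rewrite mxE normrM.
Qed.

Lemma l1M m n p (A : 'M_(m, n)) (B : 'M_(n, p)) : l1 (A *m B) <= l1 A * l1 B.
Proof.
apply: (@le_trans _ _ (\sum_i \sum_j \sum_k `|A i k| * `|B k j|)).
  apply: ler_sum => i _; apply: ler_sum => j _; rewrite mxE.
  by apply: (le_trans (ler_norm_sum _ _ _)); apply: ler_sum => k _; rewrite normrM.
rewrite /l1 mulr_suml; apply: ler_sum => i _.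
rewrite exchange_big /= mulr_suml; apply: ler_sum => k _.
rewrite -mulr_sumr ler_wpM2l// (bigD1 k)//= lerDl.
by apply: sumr_ge0 => l _; apply: sumr_ge0.
Qed.

Lemma l1_row_mx m n p (A : 'M_(m, n)) (B : 'M_(m, p)) :
  l1 (row_mx A B) = l1 A + l1 B.
Proof.
rewrite /l1 -big_split; apply: eq_bigr => i _; rewrite big_split_ord.
by congr (_ + _); apply: eq_bigr => j _; rewrite ?row_mxEl ?row_mxEr.
Qed.

Lemma l1_col_mx m n p (A : 'M_(m, n)) (B : 'M_(p, n)) :
  l1 (col_mx A B) = l1 A + l1 B.
Proof.
rewrite /l1 big_split_ord; congr (_ + _);
  by apply: eq_bigr => i _; apply: eq_bigr => j _; rewrite ?col_mxEu ?col_mxEd.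
Qed.

(** With [S = 1 + E], any [v = - v E + b] has norm at most [2 * l1 b]. The kernel of [S] satisfies
    this with [b = 0], hence vanishes; [invmx S - 1] satisfies it with [b = - E]. *)
Lemma invmx_near1 n (S : 'M[F]_n) : l1 (S - 1%:M) <= 2^-1 ->
  S \in unitmx /\ l1 (invmx S - 1%:M) <= 2 * l1 (S - 1%:M).
Proof.
set E := S - 1%:M => E2; have SE : S = 1%:M + E by rewrite addrC subrK.
have contract k (v : 'M_(k, n)) b : v = - (v *m E) + b -> l1 v <= 2 * l1 b.
  move=> vE; have : l1 v <= l1 v * l1 E + l1 b.
    rewrite {1}vE; apply: (le_trans (l1D _ _)); rewrite lerD2r.
    by rewrite -scaleN1r l1Z normrN1 mul1r l1M.
  have : l1 v * l1 E <= l1 v * 2^-1 by rewrite ler_wpM2l// l1_ge0.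
  move=> h1 h2; have := le_trans h2 (lerD h1 (lexx _)).
  rewrite -lerBlDl => h3.
  have -> : l1 v = 2 * (l1 v - l1 v * 2^-1) by field.
  by rewrite ler_pM2l.
have uS : S \in unitmx.
  rewrite -row_free_unit -kermx_eq0; apply/eqP/l1_le0.
  rewrite -[0](mulr0 2) -(l1_0 n n); apply: contract.
  apply/eqP; rewrite addr0 -addr_eq0 -[X in X + _]mulmx1 -mulmxDr -SE.
  by rewrite mulmx_ker.
split=> //; apply: (le_trans (contract _ _ (- E) _)); last first.
  by rewrite -scaleN1r l1Z normrN1 mul1r.
have XE : invmx S *m E = 1%:M - invmx S by rewrite mulmxBr mulVmx// mulmx1.
rewrite mulmxBl XE mul1mx; move: (invmx S) => T.
by apply/matrixP => i j; rewrite !mxE; ring.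
Qed.

End L1Norm.

(** * Limits with respect to a distance function *)

Section Tends.
Variables (F : numFieldType) (X : Type) (d : X -> F).

(** [d x] stands for the distance from [x] to a base point, so the sets [d x < e] play the role of
    its neighborhoods. *)
Definition eventually (P : X -> Prop) : Prop :=
  exists2 e : F, 0 < e & forall x, d x < e -> P x.

Definition tends m n (f : X -> 'M[F]_(m, n)) (a : 'M[F]_(m, n)) : Prop :=
  forall e, 0 < e -> eventually (fun x => l1 (f x - a) < e).

Lemma eventually_and (P Q : X -> Prop) :
  eventually P -> eventually Q -> eventually (fun x => P x /\ Q x).
Proof.
move=> [a a0 aP] [b b0 bQ].
have ab0 : 0 < a + b by rewrite addr_gt0.
(* Positive and below both [a] and [b], without comparing them in an order that need not be
   total. *)
exists (a * b / (a + b)); first by rewrite divr_gt0// mulr_gt0.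
move=> x dx; split; [apply: aP|apply: bQ]; apply: (lt_le_trans dx).
  by rewrite ler_pdivrMr// ler_pM2l// lerDr ltW.
by rewrite ler_pdivrMr// mulrC ler_pM2l// lerDl ltW.
Qed.

Lemma eventually_mono (P Q : X -> Prop) :
  (forall x, P x -> Q x) -> eventually P -> eventually Q.
Proof. by move=> PQ [e e0 eP]; exists e => // x /eP /PQ. Qed.

Lemma tends_cst m n (a : 'M_(m, n)) : tends (fun=> a) a.
Proof. by move=> e e0; exists 1 => // x _; rewrite subrr l1_0. Qed.

Lemma tends_le m n p q (f : X -> 'M_(m, n)) a (g : X -> 'M_(p, q)) b :
  tends f a -> (forall x, l1 (g x - b) <= l1 (f x - a)) -> tends g b.
Proof.
move=> fa gf e /fa; apply: eventually_mono => x; exact: le_lt_trans.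
Qed.

Lemma tendsD m n (f g : X -> 'M_(m, n)) a b :
  tends f a -> tends g b -> tends (fun x => f x + g x) (a + b).
Proof.
move=> fa gb e e0; have e2 : 0 < e / 2 by rewrite divr_gt0.
apply: eventually_mono (eventually_and (fa _ e2) (gb _ e2)) => x [h1 h2].
rewrite opprD addrACA; apply: (le_lt_trans (l1D _ _)).
by rewrite [e]splitr ltrD.
Qed.

Lemma tendsZ m n (c : F) (f : X -> 'M_(m, n)) a :
  tends f a -> tends (fun x => c *: f x) (c *: a).
Proof.
move=> fa e e0; have c0 : 0 < 1 + `|c| by rewrite ltr_wpDr.
have /fa : 0 < e / (1 + `|c|) by rewrite divr_gt0.
apply: eventually_mono => x; rewrite ltr_pdivlMr// => h.
rewrite -scalerBr l1Z; apply: le_lt_trans h.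
by rewrite mulrC ler_wpM2l ?l1_ge0// lerDr.
Qed.

Lemma tendsB m n (f g : X -> 'M_(m, n)) a b :
  tends f a -> tends g b -> tends (fun x => f x - g x) (a - b).
Proof.
move=> fa gb e e0; have := tendsD fa (tendsZ (-1) gb) e0.
by apply: eventually_mono => x; rewrite !scaleN1r.
Qed.

Lemma tendsM m n p (f : X -> 'M_(m, n)) (g : X -> 'M_(n, p)) a b :
  tends f a -> tends g b -> tends (fun x => f x *m g x) (a *m b).
Proof.
move=> fa gb e e0; set K := 1 + l1 a + l1 b.
have K1 : 1 <= K by rewrite /K -addrA lerDl addr_ge0 ?l1_ge0.
have K0 : 0 < K := lt_le_trans ltr01 K1.
have e2 : 0 < e / (2 * K) by rewrite divr_gt0// mulr_gt0.
apply: eventually_mono (eventually_and (eventually_and (fa _ e2) (fa _ ltr01)) (gb _ e2)).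
move=> x [[h1 h3] h2].
have -> : f x *m g x - a *m b = (f x - a) *m b + f x *m (g x - b).
  rewrite mulmxBl mulmxBr; move: (_ *m _) (_ *m _) (_ *m _) => u v w.
  by apply/matrixP => i j; rewrite !mxE; ring.
have fK : l1 (f x) <= K.
  rewrite -[f x](subrK a); apply: (le_trans (l1D _ _)).
  by rewrite /K -addrA lerD ?(ltW h3)// lerDl l1_ge0.
have bK : l1 b <= K by rewrite /K lerDr addr_ge0 ?l1_ge0.
apply: (le_lt_trans (l1D _ _)).
have -> : e = e / (2 * K) * K + K * (e / (2 * K)).
  by field; rewrite gt_eqF.
apply: ler_ltD.
  apply: (le_trans (l1M _ _)); apply: ler_pM; rewrite ?l1_ge0//; exact: ltW.
apply: (le_lt_trans (l1M _ _)).
apply: (@le_lt_trans _ _ (K * l1 (g x - b))); first by rewrite ler_wpM2r// l1_ge0.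
by rewrite ltr_pM2l.
Qed.

Lemma tends_col_mx m n p (f : X -> 'M_(m, n)) (g : X -> 'M_(p, n)) a b :
  tends f a -> tends g b -> tends (fun x => col_mx (f x) (g x)) (col_mx a b).
Proof.
move=> fa gb e e0; have e2 : 0 < e / 2 by rewrite divr_gt0.
apply: eventually_mono (eventually_and (fa _ e2) (gb _ e2)) => x [h1 h2].
by rewrite opp_col_mx add_col_mx l1_col_mx [e]splitr ltrD.
Qed.

Lemma tends_row_mx m n p (f : X -> 'M_(m, n)) (g : X -> 'M_(m, p)) a b :
  tends f a -> tends g b -> tends (fun x => row_mx (f x) (g x)) (row_mx a b).
Proof.
move=> fa gb e e0; have e2 : 0 < e / 2 by rewrite divr_gt0.
apply: eventually_mono (eventually_and (fa _ e2) (gb _ e2)) => x [h1 h2].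
by rewrite opp_row_mx add_row_mx l1_row_mx [e]splitr ltrD.
Qed.

Lemma tends_dsubmx m n p (f : X -> 'M_(m + p, n)) a :
  tends f a -> tends (fun x => dsubmx (f x)) (dsubmx a).
Proof.
move=> fa; apply: (tends_le fa) => x.
rewrite -linearB /= -[f x - a in X in _ <= X]vsubmxK l1_col_mx lerDr; exact: l1_ge0.
Qed.

Lemma tends_lsubmx m n p (f : X -> 'M_(m, n + p)) a :
  tends f a -> tends (fun x => lsubmx (f x)) (lsubmx a).
Proof.
move=> fa; apply: (tends_le fa) => x.
rewrite -linearB /= -[f x - a in X in _ <= X]hsubmxK l1_row_mx lerDl; exact: l1_ge0.
Qed.

Lemma tends_rsubmx m n p (f : X -> 'M_(m, n + p)) a :
  tends f a -> tends (fun x => rsubmx (f x)) (rsubmx a).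
Proof.
move=> fa; apply: (tends_le fa) => x.
rewrite -linearB /= -[f x - a in X in _ <= X]hsubmxK l1_row_mx lerDr; exact: l1_ge0.
Qed.

Lemma tends1_unitmx n (f : X -> 'M_n) :
  tends f 1%:M -> eventually (fun x => f x \in unitmx).
Proof.
move=> f1; have /f1 : 0 < (2^-1 : F) by rewrite invr_gt0.
by apply: eventually_mono => x /ltW /invmx_near1 [].
Qed.

Lemma tends1_invmx n (f : X -> 'M_n) :
  tends f 1%:M -> tends (fun x => invmx (f x)) 1%:M.
Proof.
move=> f1 e e0; have h2 : 0 < (2^-1 : F) by rewrite invr_gt0.
have he : 0 < e / 2 by rewrite divr_gt0.
apply: eventually_mono (eventually_and (f1 _ h2) (f1 _ he)) => x [/ltW h].
have [_ h'] := invmx_near1 h; rewrite ltr_pdivlMr// mulrC.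
exact: le_lt_trans.
Qed.

End Tends.

(** [M + t] is singular only if [t] is an eigenvalue of [- M]. There are at most [n] of these, so
    one of the [n + 1] numbers [e / 2, ..., e / (n + 2)] avoids them. *)
Lemma exists_unitmx_shift (F : numFieldType) n (M : 'M[F]_n) (e : F) : 0 < e ->
  exists2 t : F, `|t| < e & M + t%:M \in unitmx.
Proof.
move=> e0; pose p := char_poly (- M).
pose rs := [seq e / i.+2%:R | i <- iota 0 n.+1].
have urs : uniq rs.
  rewrite map_inj_uniq ?iota_uniq// => i j /(mulfI (lt0r_neq0 e0)).
  by move=> /invr_inj /eqP; rewrite eqr_nat => /eqP [].
have : ~~ all (root p) rs.
  apply/negP => ars; have := max_poly_roots (monic_neq0 (char_poly_monic _)) ars urs.
  by rewrite size_char_poly size_map size_iota ltnn.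
move=> /allPn [_ /mapP [i _ ->]] nr; exists (e / i.+2%:R).
  rewrite normrM gtr0_norm// ger0_norm ?invr_ge0//.
  by rewrite ltr_pdivrMr ?ltr0n// ltr_pMr// ltr1n.
move: nr; rewrite /p -eigenvalue_root_char /eigenvalue /eigenspace negbK kermx_eq0.
by rewrite row_free_unit -(unitmxZ (- M - _) (unitrN1 F)) scaleN1r opprB opprK addrC.
Qed.

(** * Feedback similarity *)

Section FeedbackSimilarity.
Variable R : realType.
Notation C := (R[i]).

(** Multiplying on the left by [S] and comparing blocks removes the inverse. *)
Lemma feedback_similarP m n (T T' : triple R m n) :
  feedback_similar T T' <->
  exists (U V : 'M[C]_(n, m)) (P : 'M[C]_n) (S : 'M[C]_m),
    [/\ P \in unitmx, S \in unitmx, S *m tC T' = tC T *m P,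
        S *m tB T' = tC T *m V + tB T *m S & S *m tA T' = tC T *m U + tA T *m S].
Proof.
have mulE U V P S : row_mx (tC T) (row_mx (tB T) (tA T)) *m
     block_mx P (row_mx V U) 0 (block_mx S 0 0 S) =
   row_mx (tC T *m P) (row_mx (tC T *m V + tB T *m S) (tC T *m U + tA T *m S)).
  rewrite mul_row_block mulmx0 addr0 mul_mx_row mul_row_block !mulmx0 addr0 add0r.
  by rewrite add_row_mx.
split=> -[U [V [P [S]]]].
  move=> [uP [uS]]; rewrite -mulmxA mulE => eW; exists U, V, P, S.
  have := congr1 (mulmx S) eW; rewrite mulKVmx// !mul_mx_row => /eq_row_mx [-> ].
  by move=> /eq_row_mx [-> ->].
move=> [uP uS e1 e2 e3]; exists U, V, P, S; do 2!split=> //.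
by rewrite -mulmxA mulE -e1 -e2 -e3 -!mul_mx_row mulKmx.
Qed.

Lemma feedback_similar_sym m n (T T' : triple R m n) :
  feedback_similar T T' -> feedback_similar T' T.
Proof.
move=> /feedback_similarP [U [V [P [S [uP uS e1 e2 e3]]]]]; apply/feedback_similarP.
have h (X X' : 'M[C]_m) V' : S *m X' = tC T *m V' + X *m S ->
    invmx S *m X = tC T' *m - (invmx P *m V' *m invmx S) + X' *m invmx S.
  move=> e; apply: (can_inj (mulKmx uS)); apply: (can_inj (mulmxK uS)).
  rewrite mulKVmx// mulmxDr mulmxDl !mulmxA e1 mulmxN mulNmx !mulmxA !mulmxKV// e.
  by rewrite mulmxK// addKr.
exists (- (invmx P *m U *m invmx S)), (- (invmx P *m V *m invmx S)), (invmx P), (invmx S).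
rewrite !unitmx_inv uP uS (h _ _ _ e2) (h _ _ _ e3); split=> //.
by apply: (can_inj (mulKmx uS)); rewrite mulKVmx// mulmxA e1 mulmxK.
Qed.

Lemma feedback_similar_trans m n (T1 T2 T3 : triple R m n) :
  feedback_similar T1 T2 -> feedback_similar T2 T3 -> feedback_similar T1 T3.
Proof.
move=> /feedback_similarP [U [V [P [S [uP uS e1 e2 e3]]]]].
move=> /feedback_similarP [U' [V' [P' [S' [uP' uS' e1' e2' e3']]]]].
apply/feedback_similarP.
exists (P *m U' + U *m S'), (P *m V' + V *m S'), (P *m P'), (S *m S').
split; rewrite ?unitmx_mul ?uP ?uS//.
- by rewrite -mulmxA e1' !mulmxA e1.
- by rewrite -mulmxA e2' mulmxDr !mulmxA e1 e2 mulmxDr mulmxDl !mulmxA addrA.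
- by rewrite -mulmxA e3' mulmxDr !mulmxA e1 e3 mulmxDr mulmxDl !mulmxA addrA.
Qed.

(** Equivalent to the entrywise [near_triple], in the form that [eventually] and [tends] take. *)
Definition dist m n (T T' : triple R m n) : C :=
  l1 (tC T' - tC T) + l1 (tB T' - tB T) + l1 (tA T' - tA T).

Lemma near_dist m n (T T' : triple R m n) e : dist T T' < e -> near_triple e T T'.
Proof.
move=> h; split=> [i j|]; last split=> i j; apply: le_lt_trans h.
- apply: (@le_trans _ _ (l1 (tC T' - tC T))).
    by have := entry_le_l1 (tC T' - tC T) i j; rewrite !mxE.
  by rewrite /dist -addrA lerDl addr_ge0 ?l1_ge0.
- apply: (@le_trans _ _ (l1 (tB T' - tB T))).
    by have := entry_le_l1 (tB T' - tB T) i j; rewrite !mxE.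
  by rewrite /dist addrAC lerDr addr_ge0 ?l1_ge0.
- apply: (@le_trans _ _ (l1 (tA T' - tA T))).
    by have := entry_le_l1 (tA T' - tA T) i j; rewrite !mxE.
  by rewrite /dist lerDr addr_ge0 ?l1_ge0.
Qed.

Lemma dist_near m n (e : C) : 0 < e -> exists2 e' : C, 0 < e' &
  forall T T' : triple R m n, near_triple e' T T' -> dist T T' < e.
Proof.
move=> e0; pose k := (m * n + m * m + m * m)%N.
have k0 : 0 < k.+1%:R :> C by rewrite ltr0n.
exists (e / k.+1%:R); first by rewrite divr_gt0.
move=> T T' [h1 [h2 h3]]; set e' := e / _ in h1 h2 h3 *.
apply: (@le_lt_trans _ _ (k%:R * e')); last first.
  by rewrite mulrCA gtr_pMr// ltr_pdivrMr// mul1r ltr_nat.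
rewrite /dist /k !natrD !mulrDl; apply: lerD; first apply: lerD.
all: by apply: l1_le_entry => i j; rewrite !mxE ltW.
Qed.

Lemma rigidP m n (T : triple R m n) :
  rigid T <-> eventually (dist T) (feedback_similar T).
Proof.
split=> -[e e0 eT].
  by exists e => // T' /near_dist; apply: eT.
by have [e' e'0 h] := dist_near m n e0; exists e' => // T' /h; apply: eT.
Qed.

Lemma tends_tC m n (T : triple R m n) : tends (dist T) (@tC R m n) (tC T).
Proof.
move=> e e0; exists e => // T'; apply: le_lt_trans.
by rewrite /dist -addrA lerDl addr_ge0 ?l1_ge0.
Qed.

Lemma tends_tB m n (T : triple R m n) : tends (dist T) (@tB R m n) (tB T).
Proof.
move=> e e0; exists e => // T'; apply: le_lt_trans.
by rewrite /dist addrAC lerDr addr_ge0 ?l1_ge0.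
Qed.

Lemma tends_tA m n (T : triple R m n) : tends (dist T) (@tA R m n) (tA T).
Proof.
move=> e e0; exists e => // T'; apply: le_lt_trans.
by rewrite /dist lerDr addr_ge0 ?l1_ge0.
Qed.

Lemma eventually_dist (X : Type) (d : X -> C) m n (f : X -> triple R m n) T P :
  tends d (fun x => tC (f x)) (tC T) -> tends d (fun x => tB (f x)) (tB T) ->
  tends d (fun x => tA (f x)) (tA T) -> eventually (dist T) P ->
  eventually d (fun x => P (f x)).
Proof.
move=> hC hB hA [e e0 eP]; have e3 : 0 < e / 3 by rewrite divr_gt0.
apply: eventually_mono (eventually_and (hC _ e3) (eventually_and (hB _ e3) (hA _ e3))).
move=> x [h1 [h2 h3]]; apply: eP.
have -> : e = e / 3 + e / 3 + e / 3 by field.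
by rewrite /dist !ltrD.
Qed.

(** The inverse of the transformation from [T] to [T'] is continuous, so it takes triples near [T']
    to triples near [T], and it stays within similarity classes. *)
Lemma rigid_similar m n (T T' : triple R m n) :
  feedback_similar T T' -> rigid T -> rigid T'.
Proof.
move=> TT' /rigidP rT; apply/rigidP.
have /feedback_similarP [U [V [P [S [uP uS e1 e2 e3]]]]] := TT'.
(* The equations of [feedback_similarP] solved for the original triple; the resulting map [f] takes
   [T'] to [T]. *)
pose c (X : triple R m n) := S *m tC X *m invmx P.
pose b (X : triple R m n) := (S *m tB X - c X *m V) *m invmx S.
pose a (X : triple R m n) := (S *m tA X - c X *m U) *m invmx S.
pose f (X : triple R m n) : triple R m n := (c X, b X, a X).
have cT : c T' = tC T by rewrite /c e1 mulmxK.
have bT : b T' = tB T by rewrite /b cT e2 addrC addKr mulmxK.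
have aT : a T' = tA T by rewrite /a cT e3 addrC addKr mulmxK.
have tc : tends (dist T') c (c T').
  by apply: tendsM (tends_cst _ _); apply: tendsM (tends_cst _ _) (tends_tC _).
have tb : tends (dist T') b (b T').
  apply: tendsM (tends_cst _ _); apply: tendsB; last exact: tendsM tc (tends_cst _ _).
  exact: tendsM (tends_cst _ _) (tends_tB _).
have ta : tends (dist T') a (a T').
  apply: tendsM (tends_cst _ _); apply: tendsB; last exact: tendsM tc (tends_cst _ _).
  exact: tendsM (tends_cst _ _) (tends_tA _).
rewrite cT in tc; rewrite bT in tb; rewrite aT in ta.
apply: eventually_mono (eventually_dist (f := f) tc tb ta rT) => X TX.
apply: feedback_similar_trans (feedback_similar_sym TT') _.
apply: feedback_similar_trans TX _; apply/feedback_similarP.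
exists U, V, P, S; split=> //.
- by rewrite /f /tC /= /c mulmxKV.
- by rewrite /f /tC /tB /= /b mulmxKV// addrC subrK.
- by rewrite /f /tC /tA /= /a mulmxKV// addrC subrK.
Qed.

End FeedbackSimilarity.

(** * The operator L *)

Section Reduction.
Variable R : realType.
Notation C := (R[i]).

(** The shape reached when [C] has full column rank: [U] and [V] clear the upper rows of [B] and
    [A], and only the lower rows [J] and [W] remain. *)
Definition reduced n p (J W : 'M[C]_(p, n + p)) : triple R (n + p) n :=
  (col_mx 1%:M 0, col_mx 0 J, col_mx 0 W).

(** [D] witnesses that [C] has full column rank, and the lower rows of [N] annihilate [C]. Hence
    [N C] is [G] over [0] with [G] invertible; [invmx G] normalizes [C], while [V] and [U] absorb
    the upper rows of [B] and [A]. *)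
Lemma similar_reduced n p (T : triple R (n + p) n) (D : 'M_(n + p, p)) N
    (J W : 'M_(p, n + p)) :
  row_mx (tC T) D \in unitmx -> N \in unitmx -> dsubmx N *m tC T = 0 ->
  J *m N = dsubmx N *m tB T -> W *m N = dsubmx N *m tA T ->
  feedback_similar T (reduced J W).
Proof.
move=> uCD uN piC JN WN; set G := usubmx N *m tC T.
have NC : N *m tC T = col_mx G 0 by rewrite -{1}[N]vsubmxK mul_col_mx piC.
have uG : G \in unitmx.
  have : N *m row_mx (tC T) D \in unitmx by rewrite unitmx_mul uN.
  rewrite mul_mx_row NC -[N *m D]vsubmxK -block_mxEh.
  by rewrite !unitmxE det_ublock unitrM => /andP [].
have h (X : 'M_(n + p)) K : K *m N = dsubmx N *m X -> exists V,
    invmx N *m col_mx 0 K = tC T *m V + X *m invmx N.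
  move=> KN; exists (invmx G *m (- usubmx (N *m X *m invmx N))).
  apply: (can_inj (mulKmx uN)); rewrite mulKVmx// mulmxDr (mulmxA N (tC T)) NC mul_col_mx.
  rewrite mulKVmx// mul0mx !mulmxA -{2}[N *m X *m _]vsubmxK add_col_mx addNr add0r.
  congr col_mx; apply: (can_inj (mulmxK uN)).
  rewrite KN -!mul_dsub_mx mulmxKV//.
have [V eV] := h _ _ JN; have [U eU] := h _ _ WN.
apply/feedback_similarP; exists U, V, (invmx G), (invmx N).
rewrite !unitmx_inv; split=> //; apply: (can_inj (mulKmx uN)).
by rewrite mulKVmx// mulmxA NC mul_col_mx mulmxV// mul0mx.
Qed.

(* [Lop] with p + q generalized to n: destructing [e] removes the cast. *)
Section Cast.
Variables (p q n : nat) (e : (q + p)%N = n).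

Definition cast_col (W : 'M[C]_(p, q + p + p)) : 'M[C]_(p, n + p) :=
  castmx (erefl p, congr1 (addn^~ p) e) W.

Definition pcat (X : triple R p q) : 'M[C]_(p, n + p) :=
  cast_col (row_mx (row_mx (tC X) (tB X)) (tA X)).

Definition idB : 'M[C]_(p, n + p) := cast_col (row_mx (row_mx 0 1%:M) 0).

Definition Lred (X : triple R p q) : triple R (n + p) n := reduced idB (pcat X).

End Cast.

Lemma row_blocks1 (F : fieldType) p q :
  [/\ usubmx (usubmx 1%:M) = row_mx (row_mx 1%:M 0) 0 :> 'M[F]_(q, q + p + p),
      dsubmx (usubmx 1%:M) = row_mx (row_mx 0 1%:M) 0 :> 'M[F]_(p, q + p + p) &
      dsubmx 1%:M = row_mx 0 1%:M :> 'M[F]_(p, q + p + p)].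
Proof.
rewrite (scalar_mx_block (q + p) p) block_mxEv col_mxKu col_mxKd (scalar_mx_block q p).
by split=> //; rewrite block_mxEv -(col_mx0 _ q p p) -block_mxEh block_mxEv ?col_mxKu ?col_mxKd.
Qed.

Definition unpcat p q (W : 'M[C]_(p, q + p + p)) : triple R p q :=
  (lsubmx (lsubmx W), rsubmx (lsubmx W), rsubmx W).

Lemma pcatE p q (X : triple R p q) :
  pcat (erefl (q + p)%N) X = row_mx (row_mx (tC X) (tB X)) (tA X).
Proof. by rewrite /pcat /cast_col castmx_id. Qed.

Lemma idBE p q : idB (erefl (q + p)%N) = row_mx (row_mx 0 1%:M) 0.
Proof. by rewrite /idB /cast_col castmx_id. Qed.

Lemma unpcatK p q (W : 'M[C]_(p, q + p + p)) : pcat (erefl (q + p)%N) (unpcat W) = W.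
Proof. by rewrite pcatE /tC /tB /tA /= !hsubmxK. Qed.

Lemma l1_pcatB p q (X Y : triple R p q) :
  l1 (pcat (erefl (q + p)%N) Y - pcat (erefl (q + p)%N) X) = dist X Y.
Proof. by rewrite !pcatE !opp_row_mx !add_row_mx !l1_row_mx. Qed.

Lemma Lop_Lred p q (X : triple R p q) : Lop X = Lred (addnC q p) X.
Proof.
rewrite /Lop /Lred /reduced /pcat /idB /cast_col.
by congr (_, _, _); congr (col_mx _ (castmx (_, _) _)); apply: eq_irrelevance.
Qed.

Lemma Lred_similar p q n (e : (q + p)%N = n) (X Y : triple R p q) :
  feedback_similar X Y -> feedback_similar (Lred e X) (Lred e Y).
Proof.
move=> /feedback_similar_sym /feedback_similarP [U [V [P [S [uP uS e1 e2 e3]]]]].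
case: n / e.
(* The feedback matrix with block rows [[P V U]], [[0 S 0]], [[0 0 S]] of the smaller similarity,
   now used as the change of basis between the larger triples. *)
pose N : 'M[C]_(q + p + p) := block_mx (block_mx P V 0 S) (col_mx U 0) 0 S.
have dN : dsubmx N = row_mx 0 S by rewrite /N block_mxEv col_mxKd.
have dNM k (K : 'M_(p, k)) : dsubmx N *m col_mx 0 K = S *m K.
  by rewrite dN mul_row_col mul0mx add0r.
apply: (@similar_reduced _ _ _ (col_mx 0 1%:M) N).
- rewrite /Lred /reduced /tC /= -block_mxEh -scalar_mx_block.
  exact: unitmx1.
- by rewrite unitmxE !det_ublock !unitrM -!unitmxE uP uS.
- by rewrite dN /tC /= mul_row_col mul0mx mulmx0 addr0.
- rewrite dNM idBE /N mul_row_block mul_row_block mul_row_col !mul_mx_row.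
  by rewrite !(mulmx0, mul0mx, mul1mx, mulmx1, add0r, addr0).
- rewrite dNM !pcatE /N mul_row_block mul_row_block mul_row_col !mul_mx_row.
  by rewrite !(mulmx0, mul0mx, add0r, addr0) e1 e2 e3.
Qed.

(** Triples near [Lred e X] are brought to reduced form by matrices depending continuously on them.
    The smaller triple read off is near [X], so rigidity of [X] applies. *)
Lemma Lred_rigid p q n (e : (q + p)%N = n) (X : triple R p q) :
  rigid X -> rigid (Lred e X).
Proof.
move=> /rigidP rX; apply/rigidP; case: n / e.
set e := erefl _; set T0 := Lred e X.
pose D : 'M[C]_(q + p + p, p) := col_mx 0 1%:M.
pose S (T : triple R (q + p + p) (q + p)) := row_mx (tC T) D.
(* Where [S T] is invertible, these rows form a basis of the left kernel of [tC T]. *)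
pose pi T : 'M[C]_(p, q + p + p) := dsubmx (invmx (S T)).
(* Fixed rows completing [pi T *m tB T] and [pi T] to a square matrix that equals the identity at
   [T0]. *)
pose Y : 'M[C]_(q, q + p + p) := usubmx (usubmx 1%:M).
pose N T := col_mx (col_mx Y (pi T *m tB T)) (pi T).
(* Coordinates of [pi T *m tA T] in the basis [N T]; at [T0] they give back [X]. *)
pose W T := pi T *m tA T *m invmx (N T).
have S0 : S T0 = 1%:M by rewrite /S /D /tC /= -block_mxEh -scalar_mx_block.
have pi0 : pi T0 = row_mx 0 1%:M.
  by rewrite /pi S0 invmx1 scalar_mx_block block_mxEv col_mxKd.
have tS : tends (dist T0) S 1%:M.
  by rewrite -S0; apply: tends_row_mx (tends_tC _) (tends_cst _ _).
have tpi : tends (dist T0) pi (row_mx 0 1%:M).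
  have := tends_dsubmx (tends1_invmx tS).
  by rewrite {1}scalar_mx_block block_mxEv col_mxKd.
have pi0B : row_mx 0 1%:M *m tB T0 = row_mx (row_mx 0 1%:M) 0.
  by rewrite /T0 /tB /= mul_row_col mul0mx mul1mx add0r idBE.
have pi0A : row_mx 0 1%:M *m tA T0 = pcat e X.
  by rewrite /T0 /tA /= mul_row_col mul0mx mul1mx add0r.
have tN : tends (dist T0) N 1%:M.
  have -> : 1%:M = col_mx (col_mx Y (row_mx (row_mx 0 1%:M) 0)) (row_mx 0 1%:M) :> 'M_(q + p + p).
    have [_ <- <-] := row_blocks1 C p q; by rewrite /Y !vsubmxK.
  apply: (tends_col_mx _ tpi); apply: (tends_col_mx (tends_cst _ _)).
  by rewrite -pi0B; apply: tendsM tpi (tends_tB _).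
have tW : tends (dist T0) W (pcat e X).
  rewrite -[pcat e X]mulmx1; apply: tendsM (tends1_invmx tN).
  by rewrite -pi0A; apply: tendsM tpi (tends_tA _).
rewrite pcatE in tW.
have rW : eventually (dist T0) (fun T => feedback_similar X (unpcat (W T))).
  apply: eventually_dist rX.
  - by have := tends_lsubmx (tends_lsubmx tW); rewrite !row_mxKl.
  - by have := tends_rsubmx (tends_lsubmx tW); rewrite row_mxKl row_mxKr.
  - by have := tends_rsubmx tW; rewrite row_mxKr.
have := eventually_and (tends1_unitmx tS) (eventually_and (tends1_unitmx tN) rW).
apply: eventually_mono => T [uS [uN XW]].
apply: feedback_similar_trans (Lred_similar e XW) _.
apply: feedback_similar_sym; apply: (similar_reduced uS uN).
- rewrite col_mxKd.
  have := mulVmx uS; rewrite {2}/S mul_mx_row => /(congr1 lsubmx).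
  rewrite row_mxKl => /(congr1 dsubmx); rewrite -mul_dsub_mx => ->.
  by rewrite scalar_mx_block block_mxEh row_mxKl col_mxKd.
- by rewrite idBE col_mxKd /N mul_row_col mul_row_col !mul0mx mul1mx add0r addr0.
- by rewrite unpcatK col_mxKd /W mulmxKV.
Qed.

(** * Density of orbits under L *)

Definition dense_orbit m n (T0 : triple R m n) : Prop :=
  dense_triples (fun T => feedback_similar T0 T).

Lemma l1_scale_small m n (M : 'M[C]_(m, n)) (e : C) : 0 < e ->
  exists2 e' : C, 0 < e' & forall t, `|t| < e' -> l1 (t *: M) < e.
Proof.
move=> e0; have c0 : 0 < 1 + l1 M by rewrite ltr_wpDr// l1_ge0.
exists (e / (1 + l1 M)); first by rewrite divr_gt0.
move=> t; rewrite ltr_pdivlMr// l1Z; apply: le_lt_trans.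
by rewrite ler_wpM2l// lerDr.
Qed.

(** Three small perturbations bring any triple into the orbit: that of [C] gives it full column
    rank, that of [B] makes the rows of [pi] and [pi B] independent, and that of [A] moves the
    smaller triple into the orbit of [X]. *)
Lemma Lred_dense p q n (e : (q + p)%N = n) (X : triple R p q) :
  dense_orbit X -> dense_orbit (Lred e X).
Proof.
case: n / e; set e := erefl _ => dX T eps eps0.
have eps3 : 0 < eps / 3 by rewrite divr_gt0.
pose D : 'M[C]_(q + p + p, p) := col_mx 0 1%:M.
pose E : 'M[C]_(q + p + p, q + p) := col_mx 1%:M 0.
have [e1 e10 he1] := l1_scale_small E eps3.
have [t te ut] := exists_unitmx_shift (usubmx (tC T)) e10.
pose C' := tC T + t *: E; pose S := row_mx C' D.
have uS : S \in unitmx.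
  rewrite /S /C' /D /E -[tC T]vsubmxK scale_col_mx add_col_mx -block_mxEh unitmxE.
  by rewrite det_lblock det1 mulr1 -unitmxE scalemx1.
pose N0 := invmx S; pose pi := dsubmx N0.
pose Y0 := usubmx (usubmx N0); pose Z0 := dsubmx (usubmx N0).
have [piC piD] : pi *m C' = 0 /\ pi *m D = 1%:M.
  have := mulVmx uS; rewrite /S mul_mx_row scalar_mx_block block_mxEh.
  move=> /eq_row_mx [h1 h2]; split.
    by rewrite /pi mul_dsub_mx h1 col_mxKd.
  by rewrite /pi mul_dsub_mx h2 col_mxKd.
have [e2 e20 he2] := l1_scale_small (D *m Z0) eps3.
pose M := pi *m tB T *m S.
have [s se us] := exists_unitmx_shift (rsubmx (lsubmx M)) e20.
(* Since [pi *m D = 1], adding [D *m K] to a matrix changes its product with [pi] by exactly [K].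
   The same device corrects [A] below. *)
pose B' := tB T + D *m (s *: Z0).
have piB : pi *m B' = pi *m tB T + s *: Z0 by rewrite mulmxDr mulmxA piD mul1mx.
pose N := col_mx (col_mx Y0 (pi *m B')) pi.
have uN : N \in unitmx.
  suff : N *m S \in unitmx by rewrite unitmx_mul => /andP [].
  (* Only the middle diagonal block is not an identity, and the shift by [s] has made it
     invertible. *)
  have -> : N *m S = block_mx (block_mx 1%:M 0 (lsubmx (lsubmx M))
      (rsubmx (lsubmx M) + s%:M)) (col_mx 0 (rsubmx M)) 0 1%:M.
    have [u1 u2 u3] := row_blocks1 C p q.
    have NS : N0 *m S = 1%:M by rewrite mulVmx.
    rewrite /N 2!mul_col_mx /pi [dsubmx N0 *m S]mul_dsub_mx NS.
    rewrite /Y0 !mul_usub_mx NS -/pi piB mulmxDl -/M -scalemxAl /Z0 mul_dsub_mx mul_usub_mx NS.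
    rewrite u1 u2 u3 -[M]hsubmxK -[lsubmx M]hsubmxK !scale_row_mx !add_row_mx.
    rewrite !(row_mxKl, row_mxKr) !scaler0 !addr0 scalemx1 -block_mxEv.
    by rewrite (block_mxEh (row_mx 1%:M 0)) -block_mxEv [RHS]block_mxEv.
  by rewrite unitmxE det_ublock det_lblock !det1 mul1r mulr1 -unitmxE.
pose W := pi *m tA T *m invmx N.
(* A tolerance for the smaller triple that keeps the induced change of [A] below [eps / 3]. *)
have [K K0 hK] : exists2 K : C, 0 < K & forall X' : triple R p q,
    near_triple K (unpcat W) X' -> l1 (D *m (pcat e X' - W) *m N) < eps / 3.
  have c0 : 0 < 1 + l1 D * l1 N by rewrite ltr_wpDr// mulr_ge0 ?l1_ge0.
  have /(dist_near p q) [K K0 hK] : 0 < eps / 3 / (1 + l1 D * l1 N) by rewrite divr_gt0.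
  exists K => // X' /hK; rewrite ltr_pdivlMr//; apply: le_lt_trans.
  apply: (le_trans (l1M _ _)).
  apply: (@le_trans _ _ (l1 D * l1 (pcat e X' - W) * l1 N)).
    by rewrite ler_wpM2r ?l1_ge0// l1M.
  rewrite mulrAC mulrC -{1}[W]unpcatK l1_pcatB.
  by rewrite ler_wpM2l ?lerDr// /dist !addr_ge0 ?l1_ge0.
have [X' [nX' XX']] := dX (unpcat W) K K0.
pose A' := tA T + D *m (pcat e X' - W) *m N.
exists (C', B', A'); split.
  apply: near_dist; have -> : eps = eps / 3 + eps / 3 + eps / 3 by field.
  have shift k l (Z H : 'M[C]_(k, l)) : Z + H - Z = H by rewrite addrC addKr.
  apply: ltrD; [apply: ltrD|].
  - by rewrite {1}/tC /= /C' shift he1.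
  - by rewrite {1}/tB /= /B' shift -scalemxAr he2.
  - by rewrite {1}/tA /= /A' shift hK.
apply: feedback_similar_trans (Lred_similar e XX') _.
apply: feedback_similar_sym; apply: (@similar_reduced _ _ (C', B', A') D N _ _ uS uN).
- by rewrite col_mxKd.
- by rewrite idBE col_mxKd /N mul_row_col mul_row_col !mul0mx mul1mx add0r addr0.
- rewrite col_mxKd /tA /= /A' mulmxDr !mulmxA piD mul1mx.
  by rewrite mulmxBl /W mulmxKV// addrC subrK.
Qed.

End Reduction.

(** * L-forms *)

Section LForms.
Variable R : realType.
Notation C := (R[i]).

Notation Any m n T := (existT (fun d : nat * nat => triple R d.1 d.2) (m, n) T).

(** * Uniqueness: an L-form is determined by its size *)

Lemma Any_inj m n (T T' : triple R m n) : Any m n T = Any m n T' -> T = T'.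
Proof. exact: (Eqdep_dec.inj_pair2_eq_dec _ (@eq_comparable _)). Qed.

Lemma any_triple_eq m n m' n' (T : triple R m n) (T' : triple R m' n') :
  m = m' -> n = n' ->
  (forall i j i' j', val i = val i' -> val j = val j' -> tC T i j = tC T' i' j') ->
  (forall i j i' j', val i = val i' -> val j = val j' -> tB T i j = tB T' i' j') ->
  (forall i j i' j', val i = val i' -> val j = val j' -> tA T i j = tA T' i' j') ->
  Any m n T = Any m' n' T'.
Proof.
move=> em en; subst m' n' => hC hB hA; congr existT.
case: T T' hC hB hA => [[c b] a] [[c' b'] a'] hC hB hA.
by congr (_, _, _); apply/matrixP => i j; [apply: hC|apply: hB|apply: hA].
Qed.

(** The one way in which L-forms of different depth coincide. *)
Lemma Lsig_base0 q (T : triple R 0 q) : Lsig (Any 0 q T) = base_triple R q q.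
Proof.
have e : (0 + q + 0 = q)%N by rewrite addn0.
apply: any_triple_eq => // i j i' j' ei ej.
- rewrite /tC /= [RHS]mxE -ei -ej mxE; case: splitP => [k ek|[]//].
  by rewrite mxE -val_eqE /= ek andbT.
- rewrite /tB /= [RHS]mxE mxE; case: splitP => [k ek|[]//]; by rewrite mxE.
- rewrite /tA /= [RHS]mxE mxE; case: splitP => [k ek|[]//]; by rewrite mxE.
Qed.

Lemma Lform_uniq l l' p q p' q' : (p <= q)%N -> (p' <= q')%N ->
  projT1 (Liter l (base_triple R p q)) = projT1 (Liter l' (base_triple R p' q')) ->
  Liter l (base_triple R p q) = Liter l' (base_triple R p' q').
Proof.
(* The size [(a + b + a, a + b)] has no more rows than columns only for [a = 0], where [Lsig_base0]
   applies. *)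
have base l0 p0 q0 p1 q1 : (p1 <= q1)%N ->
    projT1 (Liter l0.+1 (base_triple R p0 q0)) = projT1 (base_triple R p1 q1) ->
    Liter l0.+1 (base_triple R p0 q0) = base_triple R p1 q1.
  rewrite /Liter iterS => le1; case: (iter l0 _ _) => [[a b] T] /= [e1 e2].
  have a0 : a = 0%N by lia.
  subst a; have -> : p1 = b by lia.
  have -> : q1 = b by lia.
  exact: Lsig_base0.
elim: l l' => [|l IH] [|l'] lepq lepq'.
- by move=> [-> ->].
- by move/esym/(base _ _ _ _ _ lepq) => ->.
- exact: base.
(* L is injective on sizes, so one application cancels on both sides. *)
move=> e; rewrite /Liter !iterS; congr Lsig; apply: IH => //.
move: e; rewrite /Liter !iterS; case: (iter l _ _) => [[a b] T].
case: (iter l' _ _) => [[a' b'] T'] /=.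
by move=> [e1 e2]; congr (_, _); lia.
Qed.

Lemma is_L_form_uniq m n (T T' : triple R m n) : is_L_form T -> is_L_form T' -> T = T'.
Proof.
move=> [l [p [q [lepq e]]]] [l' [p' [q' [lepq' e']]]]; apply: Any_inj.
by rewrite -e -e'; apply: Lform_uniq => //; rewrite e e'.
Qed.

(** The invertible left block gives [C] full row rank: [P] takes [C] to [[I 0]], and [V], [U] then
    cancel [B] and [A] completely. *)
Lemma similar_base m k (T : triple R m (m + k)) : lsubmx (tC T) \in unitmx ->
  feedback_similar (pid_mx m, 0, 0) T.
Proof.
move=> uC; apply/feedback_similar_sym/feedback_similarP.
pose C1 := lsubmx (tC T); pose C2 := rsubmx (tC T).
pose P := block_mx (invmx C1) (- (invmx C1 *m C2)) 0 1%:M.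
have CP : tC T *m P = row_mx 1%:M 0.
  rewrite -[tC T]hsubmxK mul_row_block !mulmx0 addr0 mulmx1 mulmxV//.
  by rewrite mulmxN mulmxA mulmxV// mul1mx addNr.
have h X : 1%:M *m 0 = tC T *m (P *m col_mx (- X) 0) + X *m 1%:M.
  by rewrite mulmxA CP mul_row_col !mul1mx mul0mx addr0 mulmx1 addNr.
exists (P *m col_mx (- tA T) 0), (P *m col_mx (- tB T) 0), P, 1%:M.
split; rewrite ?unitmx1// ?{1}/tB ?{1}/tA /= -?h//.
  by rewrite unitmxE det_ublock unitrM -!unitmxE unitmx_inv uC unitmx1.
by rewrite CP mul1mx /tC /= pid_mx_row.
Qed.

Lemma base_rigid m k : rigid ((pid_mx m, 0, 0) : triple R m (m + k)).
Proof.
apply/rigidP; set T0 := (_, _, _).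
have tl : tends (dist T0) (fun T => lsubmx (tC T)) 1%:M.
  have := tends_lsubmx (tends_tC T0).
  by rewrite {2}/T0 {2}/tC /= pid_mx_row row_mxKl.
by apply: eventually_mono (tends1_unitmx tl) => T; apply: similar_base.
Qed.

Lemma base_dense m k : dense_orbit ((pid_mx m, 0, 0) : triple R m (m + k)).
Proof.
move=> T e e0.
have [e1 e10 he1] := l1_scale_small (row_mx 1%:M 0 : 'M[C]_(m, m + k)) e0.
have [t te ut] := exists_unitmx_shift (lsubmx (tC T)) e10.
exists (tC T + t *: row_mx 1%:M 0, tB T, tA T); split.
  apply: near_dist; rewrite /dist {1}/tC {1}/tB {1}/tA /= !subrr !l1_0 !addr0.
  by rewrite addrC addKr he1.
by apply: similar_base; rewrite /tC /= linearD /= scale_row_mx row_mxKl scalemx1.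
Qed.

Lemma exists_generic_L_form m n : (m * m < n * n + n * m)%N ->
  exists T0 : triple R m n, [/\ is_L_form T0, rigid T0 & dense_orbit T0].
Proof.
elim/ltn_ind: m n => m IH n mn; have [lemn|ltnm] := leqP m n.
  rewrite -(subnKC lemn); exists (pid_mx m, 0, 0).
  split; [|exact: base_rigid|exact: base_dense].
  by exists 0%N, m, (m + (n - m))%N; split => //; exact: leq_addr.
(* Otherwise [m * m >= 2 * n * m >= n * m + 2 * n * n]. The bound makes [q] positive. *)
have lt2 : (m < 2 * n)%N by nia.
pose p := (m - n)%N; pose q := (2 * n - m)%N.
have en : (n = p + q)%N by rewrite /p /q; lia.
have em : (m = p + q + p)%N by rewrite /p /q; lia.
have ltpm : (p < m)%N by rewrite /p; lia.
(* The quadratic form is invariant: [n * n + n * m - m * m = q * q + q * p - p * p]. *)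
have lpq : (p * p < q * q + q * p)%N by move: mn; rewrite em en; nia.
have [T [[l [a [b [leab eT]]]] rT dT]] := IH p ltpm q lpq.
move: p q en em {ltpm lpq} T eT rT dT => p q -> -> T eT rT dT.
exists (Lop T); split.
- by exists l.+1, a, b; split=> //; rewrite /Liter iterS -/(Liter _ _) eT.
- by rewrite Lop_Lred; apply: Lred_rigid.
- by rewrite Lop_Lred; apply: Lred_dense.
Qed.

(** A dense orbit meets the neighborhood supplied by the rigidity of any [T], so it contains [T].
    The converse and openness follow from invariance of rigidity under similarity. *)
Lemma rigid_dense_orbit m n (T0 : triple R m n) : rigid T0 -> dense_orbit T0 ->
  open_triples (fun T => feedback_similar T0 T) /\
  forall T, feedback_similar T0 T <-> rigid T.
Proof.
move=> r0 d0; split.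
  move=> T T0T; have [e e0 eT] := rigid_similar T0T r0.
  exists e; first exact: e0.
  move=> T' nT'.
  exact: feedback_similar_trans T0T (eT T' nT').
move=> T; split=> [T0T|[e e0 eT]]; first exact: rigid_similar r0.
have [T' [nT' T0T']] := d0 T e e0.
exact: feedback_similar_trans T0T' (feedback_similar_sym (eT T' nT')).
Qed.

End LForms.

(** * The dimension count *)

(** Each of the [N] exponents is below [b]. *)
Lemma card_bmultinom_le N b : (#|{: 'X_{1..N < b}}| <= b ^ N)%N.
Proof.
have lt_b (m : 'X_{1..N < b}) i : (m i < b)%N.
  by apply: leq_ltn_trans (bmdeg m); rewrite mdegE (bigD1 i)//= leq_addr.
pose f m : {ffun 'I_N -> 'I_b} := [ffun i => Ordinal (lt_b m i)].
rewrite -[b in (b ^ _)%N]card_ord -[N in (_ ^ N)%N]card_ord -card_ffun.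
apply: (@leq_card _ _ f) => m m' /ffunP e; apply/val_inj/mnmP => i.
by have := e i; rewrite !ffunE => /(congr1 val).
Qed.

(** The values of [h f] at [x e] form a diagonal matrix with nonzero diagonal, of rank [#|X|]. It
    factors through the coefficient space, of dimension at most [b ^ N]. *)
Lemma card_dual_family (F : fieldType) N b (X : finType) (h : X -> {mpoly F[N]})
    (x : X -> 'I_N -> F) :
  (forall f, (msize (h f) <= b)%N) -> (forall f, (h f).@[x f] != 0) ->
  (forall f e, f != e -> (h f).@[x e] = 0) -> (#|X| <= b ^ N)%N.
Proof.
move=> hb h1 h0; apply: leq_trans (card_bmultinom_le N b).
pose Y : finType := 'X_{1..N < b}.
pose y (j : 'I_#|Y|) : 'X_{1..N} := bmnm (enum_val j).
pose A : 'M[F]_(#|X|, #|Y|) := \matrix_(i, j) (h (enum_val i))@_(y j).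
pose B : 'M[F]_(#|Y|, #|X|) := \matrix_(j, i) \prod_k x (enum_val i) k ^+ (y j) k.
have AB i j : (A *m B) i j = (h (enum_val i)).@[x (enum_val j)].
  rewrite mxE [in RHS](mpolywE (hb _)) raddf_sum /=.
  rewrite [RHS](reindex (@enum_val Y Y)); last exact: onW_bij (enum_val_bij _).
  by apply: eq_bigr => k _; rewrite !mxE mevalZ mevalX.
have uAB : A *m B \in unitmx.
  have -> : A *m B = diag_mx (\row_i (h (enum_val i)).@[x (enum_val i)]).
    apply/matrixP => i j; rewrite AB !mxE; have [->|ij] := eqVneq i j.
      by rewrite mulr1n.
    by rewrite mulr0n h0// (inj_eq enum_val_inj).
  by rewrite unitmxE det_diag unitfE; apply/prodf_neq0 => i _; rewrite mxE h1.
rewrite -(mxrank_unit uAB); apply: leq_trans (mxrankM_maxl _ _) _.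
exact: rank_leq_col.
Qed.

Lemma msize_prod_le (F : fieldType) N (I : Type) (r : seq I) (P : pred I)
    (p : I -> {mpoly F[N]}) D :
  (forall i, P i -> (msize (p i) <= D)%N) ->
  (msize (\prod_(i <- r | P i) p i) <= (D.+1 * size r).+1)%N.
Proof.
move=> pD; elim: r => [|i r IH]; first by rewrite big_nil msize1 muln0.
rewrite big_cons /= mulnS; case: ifP => Pi; last by apply: leq_trans IH _; lia.
apply: leq_trans (msizeM_le _ _) _.
by rewrite ltnS addSnnS leq_add// pD.
Qed.

(* Products of Lagrange factors, one for each node of a grid of side k, are
   k ^ M polynomials of degree O(k) in N variables: too many when N < M. *)
Lemma grid_not_parametrized (F : fieldType) N (I : finType) (num : I -> {mpoly F[N]})
    (den : {mpoly F[N]}) : (N < #|I|)%N ->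
  exists2 k, (0 < k)%N & forall a : I -> 'I_k -> F, (forall i, injective (a i)) ->
    ~ forall e : {ffun I -> 'I_k}, exists x : 'I_N -> F,
        den.@[x] != 0 /\ forall i, (num i).@[x] = a i (e i) * den.@[x].
Proof.
move=> ltNI; pose D := (msize den + \sum_i msize (num i))%N.
(* [K] makes each product below of size at most [K * k], and [k = (K ^ N).+1] gives
   [(K * k) ^ N < k ^ N.+1]. *)
pose K := (D.+3 * #|I|).+1; exists (K ^ N).+1 => //.
set k := (K ^ N).+1 => a inja /fin_all_exists [x hx].
(* The factor for [i] and [j] vanishes at [x e] exactly when [e i = j], so [h f] vanishes at every
   node but [x f]. The factor [den] clears the denominators. *)
pose h (f : {ffun I -> 'I_k}) :=
  \prod_(i : I) \prod_(j : 'I_k | j != f i) (num i - a i j *: den).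
have hE f e : (h f).@[x e] =
    \prod_(i : I) \prod_(j : 'I_k | j != f i) ((a i (e i) - a i j) * den.@[x e]).
  rewrite /h rmorph_prod; apply: eq_bigr => i _; rewrite rmorph_prod.
  apply: eq_bigr => j _; have [_ hn] := hx e.
  by rewrite /= mevalB mevalZ hn mulrBl.
have /card_dual_family : forall f, (msize (h f) <= K * k)%N.
  move=> f; rewrite /h.
  have D1 i j : (msize (num i - a i j *: den) <= D)%N.
    apply: leq_trans (msizeD_le _ _) _; rewrite geq_max -scaleNr.
    rewrite (leq_trans (msizeZ_le _ _)) ?leq_addr// andbT.
    by rewrite /D (bigD1 i)//= addnCA leq_addr.
  apply: leq_trans (msize_prod_le _ _) _.
    move=> i _; by apply: msize_prod_le => j _; apply: D1.
  have szE (T : finType) : size (index_enum T) = #|T| by rewrite [index_enum T]unlock -enumT cardT.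
  rewrite !szE card_ord /K; move: #|I| => M; nia.
move=> /(_ x); rewrite card_ffun card_ord => h1.
suff : (k ^ #|I| <= (K * k) ^ N)%N.
  apply/negP; rewrite -ltnNge expnMn.
  apply: (@leq_trans (k * k ^ N)); last by rewrite -expnS leq_pexp2l.
  by rewrite ltn_pmul2r ?expn_gt0.
apply: h1.
  move=> f; rewrite hE; apply/prodf_neq0 => i _; apply/prodf_neq0 => j jf.
  have [dn _] := hx f; rewrite mulf_neq0// subr_eq0; apply: contraNneq jf.
  by move/inja->.
move=> f e fe; have [i fei] : exists i, f i != e i.
  apply/existsP; apply: contraNT fe; rewrite negb_exists => /forallP fe.
  by apply/eqP/ffunP => i; apply/eqP; have := fe i; rewrite negbK.
rewrite hE (bigD1 i)//= (bigD1 (e i))/=; last by rewrite eq_sym.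
by rewrite subrr !mul0r.
Qed.

(** * Too few parameters for an open orbit *)

Section NotRigid.
Variable R : realType.
Notation C := (R[i]).

(** The orbit of [T] is the image of a rational map in the [#|J|] entries of [U], [V], [P], [S].
    Rigidity would put a whole grid around [T], in [#|I|] coordinates, into this image. *)
Lemma not_rigid m n (T : triple R m n) : (n * n + n * m < m * m)%N -> ~ rigid T.
Proof.
move=> ltmn [e e0 rT].
pose I : finType := ('I_m * 'I_(n + (m + m)))%type.
pose J : finType := ('I_n * 'I_m + 'I_n * 'I_m + 'I_n * 'I_n + 'I_m * 'I_m)%type.
(* This is [2nm + n^2 + m^2 < mn + 2m^2], the hypothesis up to cancellation. *)
have ltJI : (#|J| < #|I|)%N by rewrite !card_sum !card_prod !card_ord; nia.
pose X (j : J) : {mpoly C[#|J|]} := 'X_(enum_rank j).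
pose Up : 'M_(n, m) := \matrix_(i, j) X (inl (inl (inl (i, j)))).
pose Vp : 'M_(n, m) := \matrix_(i, j) X (inl (inl (inr (i, j)))).
pose Pp : 'M_n := \matrix_(i, j) X (inl (inr (i, j))).
pose Sp : 'M_m := \matrix_(i, j) X (inr (i, j)).
pose W : 'M[C]_(m, n + (m + m)) := row_mx (tC T) (row_mx (tB T) (tA T)).
(* The adjugate replaces [invmx S], leaving polynomial entries over the common denominator
   [\det Sp]. *)
pose num := \adj Sp *m map_mx (@mpolyC #|J| C) W *m
  block_mx Pp (row_mx Vp Up) 0 (block_mx Sp 0 0 Sp).
have [k k0 hk] := grid_not_parametrized (fun i : I => num i.1 i.2) (\det Sp) ltJI.
have kn0 : k%:R != 0 :> C by rewrite pnatr_eq0 -lt0n.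
(* Grid of step [e / k]: as [j < k], every node stays within [e] of [T]. *)
apply: (hk (fun i j => W i.1 i.2 + e * (j : nat)%:R / k%:R)).
  move=> i j j' /addrI /(mulIf (invr_neq0 kn0)) /(mulfI (lt0r_neq0 e0)) /eqP.
  by rewrite eqr_nat => /eqP /val_inj.
move=> f; pose W' := \matrix_(i, j) (W i j + e * (f (i, j) : nat)%:R / k%:R).
pose T' : triple R m n := (lsubmx W', lsubmx (rsubmx W'), rsubmx (rsubmx W')).
have nW i j : `|W' i j - W i j| < e.
  rewrite mxE addrC addKr normrM normfV normrM gtr0_norm// !normr_nat.
  by rewrite ltr_pdivrMr ?ltr0n// ltr_pM2l// ltr_nat.
have nTT' : near_triple e T T'.
  split=> [i j|]; last split=> i j.
  - have -> : tC T' i j = W' i (lshift _ j) by rewrite [LHS]mxE.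
    by have := nW i (lshift _ j); rewrite /W row_mxEl.
  - have -> : tB T' i j = W' i (rshift _ (lshift _ j)) by rewrite 2![LHS]mxE.
    by have := nW i (rshift _ (lshift _ j)); rewrite /W row_mxEr row_mxEl.
  - have -> : tA T' i j = W' i (rshift _ (rshift _ j)) by rewrite 2![LHS]mxE.
    by have := nW i (rshift _ (rshift _ j)); rewrite /W row_mxEr row_mxEr.
have [U [V [P [S [uP [uS]]]]]] := rT _ nTT'.
rewrite -/W /T' /tC /tB /tA /= !hsubmxK => eW.
pose v (l : 'I_#|J|) : C := match enum_val l with
  | inl (inl (inl ij)) => U ij.1 ij.2 | inl (inl (inr ij)) => V ij.1 ij.2
  | inl (inr ij) => P ij.1 ij.2 | inr ij => S ij.1 ij.2 end.
have vX j : (X j).@[v] = v (enum_rank j) by rewrite mevalXU.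
have vS : map_mx (meval v) Sp = S.
  by apply/matrixP => i j; rewrite !mxE vX /v enum_rankK.
have vP : map_mx (meval v) Pp = P.
  by apply/matrixP => i j; rewrite !mxE vX /v enum_rankK.
have vU : map_mx (meval v) Up = U.
  by apply/matrixP => i j; rewrite !mxE vX /v enum_rankK.
have vV : map_mx (meval v) Vp = V.
  by apply/matrixP => i j; rewrite !mxE vX /v enum_rankK.
have vden : (\det Sp).@[v] = \det S by rewrite -vS det_map_mx.
exists v; rewrite vden; split; first by rewrite -unitfE -unitmxE.
move=> [i j]; rewrite [RHS]mulrC /=.
have -> : W i j + e * (f (i, j) : nat)%:R / k%:R = W' i j by rewrite [RHS]mxE.
have -> : \det S * W' i j = (\det S *: W') i j by rewrite [RHS]mxE.
rewrite eW /invmx uS -scalemxAl -scalemxAl scalerA mulfV -?unitfE -?unitmxE// scale1r.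
have -> : (num i j).@[v] = (map_mx (meval v) num) i j by rewrite [RHS]mxE.
rewrite /num !map_mxM map_block_mx [map_mx _ (row_mx Vp Up)]map_row_mx.
rewrite map_block_mx !raddf0 vP vV vU vS.
rewrite map_mx_adj vS -map_mx_comp.
by rewrite (map_mx_id _ _)// => z; rewrite /= mevalC.
Qed.

End NotRigid.

(** * The theorem *)

Lemma lt_golden (R : realType) (m n : nat) :
  (m%:R : R) < n%:R * (1 + Num.sqrt 5) / 2 -> (0 < n)%N ->
  (m * m < n * n + n * m)%N.
Proof.
move=> h n0; have s0 : 0 <= Num.sqrt 5 :> R := sqrtr_ge0 _.
have s2 : Num.sqrt 5 ^+ 2 = 5 :> R by rewrite sqr_sqrtr.
rewrite -(ltr_nat R) !natrD !natrM.
have : 0 < n%:R :> R by rewrite ltr0n.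
have : 0 <= m%:R :> R by rewrite ler0n.
move: (Num.sqrt 5) s0 s2 (m%:R) (n%:R) h => s s0 s2 x y h x0 y0.
(* Squaring gives [x^2 < y^2 + x y]. A negative left side is treated apart, since squaring is
   monotone only on nonnegative numbers. *)
have h' : 2 * x - y < y * s by lra.
have [h1|h1] := ltrP (2 * x - y) 0; first by nra.
have : (2 * x - y) ^+ 2 < (y * s) ^+ 2 by rewrite ltr_pXn2r// nnegrE mulr_ge0// ltW.
rewrite exprMn s2; nra.
Qed.

Lemma gt_golden (R : realType) (m n : nat) :
  (m%:R : R) > n%:R * (1 + Num.sqrt 5) / 2 ->
  (n * n + n * m < m * m)%N.
Proof.
move=> h; have s0 : 0 <= Num.sqrt 5 :> R := sqrtr_ge0 _.
have s2 : Num.sqrt 5 ^+ 2 = 5 :> R by rewrite sqr_sqrtr.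
rewrite -(ltr_nat R) !natrD !natrM.
have : 0 <= n%:R :> R by rewrite ler0n.
move: (Num.sqrt 5) s0 s2 (m%:R) (n%:R) h => s s0 s2 x y h y0.
have h' : y * s < 2 * x - y by lra.
have ys0 : 0 <= y * s by rewrite mulr_ge0.
have : (y * s) ^+ 2 < (2 * x - y) ^+ 2.
  by rewrite ltr_pXn2r// nnegrE ltW// (le_lt_trans ys0).
rewrite exprMn s2; nra.
Qed.

Theorem theorem11 (R : realType) (m n : nat) (m_gt0 : (0 < m)%N) (n_gt0 : (0 < n)%N) :
  ((m%:R : R) < n%:R * (1 + Num.sqrt 5) / 2 ->
     exists T0 : triple R m n,
       is_L_form T0 /\
       (forall T : triple R m n, is_L_form T -> T = T0) /\
       open_triples (fun T => feedback_similar T0 T) /\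
       dense_triples (fun T => feedback_similar T0 T) /\
       (forall T : triple R m n, feedback_similar T0 T <-> rigid T)) /\
  ((m%:R : R) > n%:R * (1 + Num.sqrt 5) / 2 ->
     forall T : triple R m n, ~ rigid T).
Proof.
split=> [h|h T]; last exact: not_rigid (gt_golden h).
have [T0 [L0 r0 d0]] := exists_generic_L_form R (lt_golden h n_gt0).
have [o0 rE] := rigid_dense_orbit r0 d0.
exists T0; split=> //; split=> [T LT|]; [exact: is_L_form_uniq LT L0|by []].
Qed.
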